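(* Let $H$ be the (1+1) timelike $\kappa$-Poincaré quantum algebra with deformation parameter $\omega$, i.e. the Hopf algebra deformation of $U(\mathfrak{p}(1+1))$ generated by $P_0,P_1,K$ with commutation relations $$[P_0,P_1]=0,\qquad [K,P_0]=P_1,\qquad [K,P_1]=\frac{e^{4\omega P_0}-1}{4\omega}+\omega P_1^2,$$ and coproducts $$\Delta(P_0)=P_0\otimes 1+1\otimes P_0,\quad \Delta(P_1)=P_1\otimes e^{2\omega P_0}+1\otimes P_1,\quad \Delta(K)=K\otimes e^{2\omega P_0}+1\otimes K.$$ Let $X^{abc}=P_0^aP_1^bK^c$ ($a,b,c\in\mathbb{Z}_{\ge 0}$) be the ordered basis of $H$, let $x_{abc}\in H^*$ be the dual basis, and put $a_0=x_{100}$, $a_1=x_{010}$, $\chi=x_{001}$. Then the universal $T$-matrix $T=\sum_{a,b,c}x_{abc}\otimes X^{abc}$ of $H$ is $$T=e^{a_0\otimes P_0}\,e^{a_1\otimes P_1}\,e^{\chi\otimes K}.$$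
   Context: Everything is understood formally in the deformation parameter: $H$ is a topologically free $\mathbb{R}[[\omega]]$-module with topological basis $X^{abc}$ (expressions such as $(e^{4\omega P_0}-1)/(4\omega)$ are power series in $\omega$), and $\omega\to 0$ gives the universal enveloping algebra of the (1+1) Poincaré Lie algebra $[P_0,P_1]=0$, $[K,P_0]=P_1$, $[K,P_1]=P_0$. $H^*$ is the dual, whose elements are (possibly infinite) combinations of the dual basis elements $x_{abc}$, defined by $\langle x_{abc},X^{ijk}\rangle=\delta_a^i\delta_b^j\delta_c^k$. The product of $H^*$ is dual to the coproduct of $H$: $\langle xy,X\rangle=\langle x\otimes y,\Delta(X)\rangle$; the coproduct of $H^*$ is dual to the product of $H$. The universal $T$-matrix (Hopf algebra dual form) is the canonical element $T=\sum_\mu x_\mu\otimes X^\mu$ of the (completed) tensor product $H^*\otimes H$, for dual bases $X^\mu$ of $H$ and $x_\mu$ of $H^*$. For $x\in H^*$, $X\in H$, $e^{x\otimes X}:=\sum_{n\ge0}\frac{1}{n!}\,x^n\otimes X^n$. *)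

(* Defs.v *)
From HB Require Import structures.
From mathcomp Require Import all_boot all_order all_algebra.
From mathcomp Require Import finmap.
From mathcomp Require Import mathcomp_extra boolp classical_sets reals.

Set Implicit Arguments.
Unset Strict Implicit.
Unset Printing Implicit Defensive.

Import GRing.Theory.
Local Open Scope ring_scope.

Record fps (R : Type) := FPS { fpscoef : nat -> R }.
Arguments FPS {R} _.

Lemma fpsP (R : Type) (f g : fps R) :
  (forall n, fpscoef f n = fpscoef g n) -> f = g.
Proof. by case: f g => [f] [g] /= /funext ->. Qed.

HB.instance Definition _ (R : Type) := gen_eqMixin (fps R).
HB.instance Definition _ (R : Type) := gen_choiceMixin (fps R).

Section FpsRing.
Variable R : comNzRingType.
Implicit Types f g h : fps R.

Definition fps_zero : fps R := FPS (fun=> 0).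
Definition fpsC (a : R) : fps R := FPS (fun n => if n == 0%N then a else 0).
Definition fps_opp f := FPS (fun n => - fpscoef f n).
Definition fps_add f g := FPS (fun n => fpscoef f n + fpscoef g n).
Definition fps_mul f g :=
  FPS (fun n => \sum_(i < n.+1) fpscoef f i * fpscoef g (n - i)).

Fact fps_addA : associative fps_add.
Proof. by move=> f g h; apply: fpsP => n /=; rewrite addrA. Qed.
Fact fps_addC : commutative fps_add.
Proof. by move=> f g; apply: fpsP => n /=; rewrite addrC. Qed.
Fact fps_add0 : left_id fps_zero fps_add.
Proof. by move=> f; apply: fpsP => n /=; rewrite add0r. Qed.
Fact fps_addN : left_inverse fps_zero fps_opp fps_add.
Proof. by move=> f; apply: fpsP => n /=; rewrite addNr. Qed.

HB.instance Definition _ :=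
  GRing.isZmodule.Build (fps R) fps_addA fps_addC fps_add0 fps_addN.

Let trunc n f : {poly R} := \poly_(i < n.+1) fpscoef f i.

Let coef_trunc n f i : (i <= n)%N -> (trunc n f)`_i = fpscoef f i.
Proof. by move=> le_in; rewrite coef_poly ltnS le_in. Qed.

Let coef_trunc_mul n f g i : (i <= n)%N ->
  (trunc n f * trunc n g)`_i = fpscoef (fps_mul f g) i.
Proof.
move=> le_in; rewrite coefM; apply: eq_bigr => j _.
rewrite !coef_trunc ?(leq_trans _ le_in) ?leq_subr //.
by rewrite -ltnS.
Qed.

Fact fps_mulA : associative fps_mul.
Proof.
move=> f g h; apply: fpsP => n.
transitivity ((trunc n f * (trunc n g * trunc n h))`_n).
  rewrite coefM; apply: eq_bigr => i _.
  by rewrite coef_trunc -1?ltnS // coef_trunc_mul // leq_subr.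
rewrite mulrA coefM; apply: eq_bigr => i _.
by rewrite coef_trunc_mul -1?ltnS // coef_trunc // leq_subr.
Qed.

Fact fps_mulC : commutative fps_mul.
Proof.
move=> f g; apply: fpsP => n.
by rewrite -!(@coef_trunc_mul n) // mulrC.
Qed.

Fact fps_mul1 : left_id (fpsC 1) fps_mul.
Proof.
move=> f; apply: fpsP => n /=.
rewrite big_ord_recl /= subn0 mul1r big1 ?addr0 // => i _.
by rewrite mul0r.
Qed.

Fact fps_mulDl : left_distributive fps_mul fps_add.
Proof.
move=> f g h; apply: fpsP => n /=; rewrite -big_split.
by apply: eq_bigr => i _; rewrite mulrDl.
Qed.

Fact fps_oner_neq0 : fpsC 1 != 0 :> fps R.
Proof.
apply/eqP => /(congr1 (fun f => fpscoef f 0)) /=.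
by apply/eqP; rewrite oner_eq0.
Qed.

HB.instance Definition _ := GRing.Zmodule_isComNzRing.Build (fps R)
  fps_mulA fps_mulC fps_mul1 fps_mulDl fps_oner_neq0.

Definition omega : fps R := FPS (fun n => (n == 1%N)%:R).

End FpsRing.

Arguments omega {R}.

Definition choose_or (T : Type) (x0 : T) (P : T -> Prop) : T :=
  if pselect (exists x, P x) is left ex then projT1 (cid ex) else x0.

Lemma choose_orP (T : Type) (x0 : T) (P : T -> Prop) :
  (exists x, P x) -> P (choose_or x0 P).
Proof. by rewrite /choose_or; case: pselect => // ex _; case: cid. Qed.

Section Adic.
Variables (R : comNzRingType) (M : lmodType (fps R)).

Definition adic (n : nat) (m : M) : Prop := exists m', m = omega ^+ n *: m'.

Definition adic_cvg (u : nat -> M) (l : M) : Prop :=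
  forall n, exists N, forall i, (N <= i)%N -> adic n (u i - l).

Definition adic_cauchy (u : nat -> M) : Prop :=
  forall n, exists N, forall i j, (N <= i)%N -> (N <= j)%N -> adic n (u i - u j).

Definition adic_complete : Prop :=
  (forall m : M, (forall n, adic n m) -> m = 0) /\
  (forall u : nat -> M, adic_cauchy u -> exists l, adic_cvg u l).

(* Unordered summation: the net of finite partial sums converges w-adically. *)
Definition has_adic_sum (I : choiceType) (u : I -> M) (s : M) : Prop :=
  forall n, exists F0 : {fset I}, forall F : {fset I},
    (F0 `<=` F)%fset -> adic n (\sum_(i <- F) u i - s).

Definition adic_sum (I : choiceType) (u : I -> M) : M :=
  choose_or 0 (has_adic_sum u).

End Adic.

Section AdicFps.
Variable R : comNzRingType.

Lemma coef_omegaM n (f : fps R) i :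
  fpscoef (omega ^+ n * f) i = if (i < n)%N then 0 else fpscoef f (i - n).
Proof.
elim: n i => [|n IHn] i; first by rewrite mul1r subn0.
rewrite exprS -mulrA; case: i => [|i].
  by rewrite [LHS]big_ord1 /= mul0r.
rewrite [LHS]big_ord_recl /= mul0r add0r [LHS]big_ord_recl.
rewrite [X in _ + X]big1 ?addr0 => [|j _]; last exact: mul0r.
by rewrite mul1r -[LHS]/(fpscoef (omega ^+ n * f) (i.+1 - 1)) subn1 IHn ltnS.
Qed.

Lemma adic_fpsP n (f : (fps R)^o) :
  adic n f <-> forall i, (i < n)%N -> fpscoef f i = 0.
Proof.
split=> [[g ->] i lt_in|f0].
  by rewrite -[_ *: g]/(omega ^+ n * g) coef_omegaM lt_in.
exists (FPS (fun i => fpscoef f (i + n))); apply: fpsP => i.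
rewrite -[_ *: _]/(omega ^+ n * _) coef_omegaM.
by case: ltnP => [/f0//|le_ni]; rewrite /= subnK.
Qed.

Lemma fps_complete : adic_complete (fps R)^o.
Proof.
split=> [f f0|u cu].
  by apply: fpsP => i; apply: (adic_fpsP i.+1 f).1.
have /choice[N uN] := cu.
have uE n i k : (N n <= i)%N -> (k < n)%N ->
    fpscoef (u i) k = fpscoef (u (N n)) k.
  move=> leNi lt_kn; apply/eqP; rewrite -subr_eq0; apply/eqP.
  exact: ((adic_fpsP n (u i - u (N n))).1 (uN n i _ leNi (leqnn _))).
exists (FPS (fun k => fpscoef (u (N k.+1)) k)) => n; exists (N n) => i leNi.
apply/adic_fpsP => k lt_kn.
rewrite -[LHS]/(fpscoef (u i) k - fpscoef (u (N k.+1)) k).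
rewrite (uE n) // -(uE n (maxn (N n) (N k.+1))) ?leq_maxl //.
by rewrite (uE k.+1) ?leq_maxr // subrr.
Qed.

End AdicFps.

Section AdicTheory.
Variables (R : comNzRingType) (M : lmodType (fps R)).
Hypothesis cM : adic_complete M.

Lemma adic0 n : adic n (0 : M).
Proof. by exists 0; rewrite scaler0. Qed.

Lemma adicD n (x y : M) : adic n x -> adic n y -> adic n (x + y).
Proof. by move=> [a ->] [b ->]; exists (a + b); rewrite scalerDr. Qed.

Lemma adicZ n a (x : M) : adic n x -> adic n (a *: x).
Proof. by move=> [b ->]; exists (a *: b); rewrite !scalerA mulrC. Qed.

Lemma adicN n (x : M) : adic n x -> adic n (- x).
Proof. by rewrite -scaleN1r; apply: adicZ. Qed.

Lemma adicW m n (x : M) : (m <= n)%N -> adic n x -> adic m x.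
Proof.
move=> /subnKC <- [a ->]; exists (omega ^+ (n - m) *: a).
by rewrite scalerA exprD.
Qed.

Lemma has_adic_sum_unique (I : choiceType) (u : I -> M) s t :
  has_adic_sum u s -> has_adic_sum u t -> s = t.
Proof.
move=> us ut; apply/eqP; rewrite -subr_eq0; apply/eqP; apply: cM.1 => n.
have [F sF] := us n; have [G tG] := ut n.
have := adicD (tG _ (fsubsetUr F G)) (adicN (sF _ (fsubsetUl F G))).
by rewrite opprB addrC addrA addrNK.
Qed.

Lemma adic_sumE (I : choiceType) (u : I -> M) s :
  has_adic_sum u s -> adic_sum u = s.
Proof.
move=> us; apply: (has_adic_sum_unique _ us).
by apply: (@choose_orP _ _ (has_adic_sum u)); exists s.
Qed.

Lemma has_adic_sum_nat (u : nat -> M) :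
  (forall n, adic n (u n)) -> has_adic_sum u (adic_sum u).
Proof.
move=> u0; apply: (@choose_orP _ _ (has_adic_sum u)).
have tail n N : (n <= N)%N -> adic n (\sum_(n <= i < N) u i).
  move=> _; rewrite big_nat_cond; elim/big_ind: _ => [|x y|i].
  - exact: adic0.
  - exact: adicD.
  - by rewrite andbT => /andP[le_ni _]; apply: adicW (u0 i).
have [|l ul] := cM.2 (fun N => \sum_(0 <= i < N) u i).
  move=> n; exists n => i j le_ni le_nj.
  rewrite (big_cat_nat _ le_ni) // (big_cat_nat _ le_nj) //=.
  rewrite opprD addrACA subrr add0r.
  by apply: adicD; [|apply: adicN]; apply: tail.
exists l => n; have [N0 lN] := ul n.
pose N := maxn N0 n; exists [fset i in iota 0 N]%fset => F sF.
have -> : \sum_(i <- F) u i - l =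
    (\sum_(0 <= i < N) u i - l) + \sum_(i <- F | (N <= i)%N) u i.
  rewrite (bigID (fun i => (N <= i)%N)) /= addrC addrAC; congr (_ - _ + _).
  rewrite -big_filter; apply: perm_big; apply: uniq_perm.
  - by rewrite filter_uniq // fset_uniq.
  - exact: iota_uniq.
  move=> i; rewrite mem_filter -ltnNge mem_index_iota /=.
  case: ltnP => //= lt_iN; apply: (fsubsetP sF).
  by rewrite !inE mem_iota.
apply: adicD; first exact/lN/leq_maxl.
elim/big_ind: _ => [|x y|i le_Ni]; [exact: adic0|exact: adicD|].
by apply: adicW (u0 i); apply: leq_trans le_Ni; apply: leq_maxr.
Qed.

Lemma has_adic_sum_cvg (u : nat -> M) s :
  has_adic_sum u s -> adic_cvg (fun N => \sum_(i < N) u i) s.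
Proof.
move=> us n; have [F0 sF] := us n.
exists (\max_(i <- F0) i).+1 => N le_N.
have := sF [fset i in iota 0 N]%fset.
suff -> : \sum_(i <- [fset i in iota 0 N]%fset) u i = \sum_(i < N) u i.
  apply; apply/fsubsetP => i iF; rewrite !inE mem_iota /= add0n.
  by apply: leq_trans le_N; rewrite ltnS; exact: (@leq_bigmax_seq _ _ xpredT id).
rewrite -(big_mkord xpredT u); apply: perm_big; apply: uniq_perm.
- exact: fset_uniq.
- exact: iota_uniq.
by move=> i; rewrite !inE mem_index_iota mem_iota.
Qed.

Lemma adic_cvg_unique (u : nat -> M) s t :
  adic_cvg u s -> adic_cvg u t -> s = t.
Proof.
move=> us ut; apply/eqP; rewrite -subr_eq0; apply/eqP; apply: cM.1 => n.
have [F sF] := us n; have [G tG] := ut n.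
have := adicD (tG _ (leq_maxr F G)) (adicN (sF _ (leq_maxl F G))).
by rewrite opprB addrC addrA addrNK.
Qed.

End AdicTheory.

(* A family of scalars tending to 0 w-adically: for every n, all but finitely
   many members are divisible by w^n. *)
Definition null_family (R : comNzRingType) (I : choiceType) (c : I -> fps R) :=
  forall n, exists F : {fset I}, forall i,
    i \notin F -> adic n (c i : (fps R)^o).

(* In a complete module this says that M is topologically free on e. *)
Definition topological_basis (R : comNzRingType) (M : lmodType (fps R))
    (I : choiceType) (e : I -> M) : Prop :=
  forall m : M, exists! c : I -> fps R,
    null_family c /\ has_adic_sum (fun i => c i *: e i) m.

Lemma linear_ext (R : pzRingType) (U V : lmodType R) (f g : {linear U -> V}) :
  f =1 g -> f = g.
Proof.
move=> /funext; case: f g => [f [[fD] [fZ]]] [g [[gD] [gZ]]] /= fg.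
by subst g; rewrite (Prop_irrelevance gD fD) (Prop_irrelevance gZ fZ).
Qed.

(* T, with t : M -> N -> T, is the w-adically completed tensor product of M and
   N: the universal complete target of R[[w]]-bilinear maps on M x N. *)
Definition is_ctensor (R : comNzRingType) (M N T : lmodType (fps R))
    (t : M -> N -> T) : Prop :=
  [/\ bilinear_for *:%R *:%R t, adic_complete T &
      forall (P : lmodType (fps R)) (f : M -> N -> P),
        adic_complete P -> bilinear_for *:%R *:%R f ->
        exists F : {linear T -> P},
          (forall u v, F (t u v) = f u v) /\
          (forall G : {linear T -> P}, (forall u v, G (t u v) = f u v) -> G =1 F)].

(* The linear map T -> P extending the bilinear map f along t. The default
   value 0 is taken only if f is not bilinear or P is not complete. *)
Definition ctlift (R : comNzRingType) (M N T P : lmodType (fps R))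
    (t : M -> N -> T) (f : M -> N -> P) : {linear T -> P} :=
  choose_or (\0 : {linear T -> P}) (fun F => forall u v, F (t u v) = f u v).

Lemma ctliftE (R : comNzRingType) (M N T P : lmodType (fps R))
    (t : M -> N -> T) (f : M -> N -> P) :
  is_ctensor t -> adic_complete P -> bilinear_for *:%R *:%R f ->
  forall u v, ctlift t f (t u v) = f u v.
Proof.
move=> [_ _ ut] cP bf.
apply: (@choose_orP _ _ (fun F : {linear T -> P} =>
  forall u v, F (t u v) = f u v)).
by have [F [? _]] := ut P f cP bf; exists F.
Qed.

Lemma ctlift_unique (R : comNzRingType) (M N T P : lmodType (fps R))
    (t : M -> N -> T) (f : M -> N -> P) (G : {linear T -> P}) :
  is_ctensor t -> adic_complete P -> bilinear_for *:%R *:%R f ->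
  (forall u v, G (t u v) = f u v) -> G =1 ctlift t f.
Proof.
move=> ct cP bf Gf x; have [_ _ ut] := ct; have [F [_ uF]] := ut P f cP bf.
by rewrite (uF G Gf) (uF _ (ctliftE ct cP bf)).
Qed.

(* hsq is H (x) H, with product (u (x) v)(u' (x) v') = uu' (x) vv', and hcube is
   (H (x) H) (x) H; all tensor products are completed. *)
Record hopfAlgebra (R : comNzRingType) := HopfAlgebra {
  halg :> algType (fps R);
  halg_complete : adic_complete halg;

  hsq : algType (fps R);
  htens : halg -> halg -> hsq;
  htens_ctensor : is_ctensor htens;
  htens1 : htens 1 1 = 1;
  htensM : forall u v u' v',
    htens u v * htens u' v' = htens (u * u') (v * v');

  hcube : lmodType (fps R);
  htens3 : hsq -> halg -> hcube;
  htens3_ctensor : is_ctensor htens3;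

  coproduct : {lrmorphism halg -> hsq};
  counit : {lrmorphism halg -> (fps R)^o};
  antipode : {linear halg -> halg};

  (* (coproduct (x) id) o coproduct = (id (x) coproduct) o coproduct *)
  coproductA : forall h,
    ctlift htens (fun u v => htens3 (coproduct u) v) (coproduct h) =
    ctlift htens
      (fun u v => ctlift htens (fun v1 v2 => htens3 (htens u v1) v2)
                    (coproduct v))
      (coproduct h);
  counitl : forall h, ctlift htens (fun u v => counit u *: v) (coproduct h) = h;
  counitr : forall h, ctlift htens (fun u v => counit v *: u) (coproduct h) = h;
  antipodel : forall h,
    ctlift htens (fun u v => antipode u * v) (coproduct h) = (counit h)%:A;
  antipoder : forall h,
    ctlift htens (fun u v => u * antipode v) (coproduct h) = (counit h)%:A
}.

Section Dual.
Variables (R : comUnitRingType) (H : hopfAlgebra R).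

(* Linear functionals are automatically w-adically continuous. *)
Definition dual := {linear H -> (fps R)^o}.

(* <xy, h> = <x (x) y, coproduct h> *)
Definition dual_mul (x y : dual) : dual :=
  (ctlift (@htens _ H) (fun u v => x u * y v : (fps R)^o) \o coproduct H
     : {linear H -> (fps R)^o}).

Definition dual_one : dual := counit H.

Definition dual_exp (x : dual) (n : nat) : dual :=
  iter n (dual_mul x) dual_one.

(* H^* carries the topology of pointwise convergence, in which its elements are
   the infinite combinations of the members of a dual basis. The completed
   tensor product of H^* and H is then the module of linear endomorphisms of H,
   with x (x) X acting by h |-> <x, h> X, under pointwise w-adic convergence. *)
Definition dualtens := {linear H -> H}.

Definition dtens_fun (x : dual) (X : H) (h : H) : H := (x h : fps R) *: X.

Fact dtens_is_linear x X : linear (dtens_fun x X).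
Proof.
move=> a u v; rewrite /dtens_fun linearP scalerDl.
by rewrite -[a *: x u]/(a * x u) scalerA.
Qed.

HB.instance Definition _ x X :=
  GRing.isLinear.Build (fps R) H H *:%R (dtens_fun x X) (dtens_is_linear x X).

Definition dtens (x : dual) (X : H) : dualtens := dtens_fun x X.

(* The continuous extension of (x (x) X)(y (x) Y) = xy (x) XY; see dtensM. *)
Definition dt_mul (s t : dualtens) : dualtens :=
  (ctlift (@htens _ H) (fun u v => s u * t v) \o coproduct H
     : {linear H -> H}).

Lemma dtensM x y X Y :
  dt_mul (dtens x X) (dtens y Y) = dtens (dual_mul x y) (X * Y).
Proof.
apply: linear_ext => h /=; rewrite /dtens_fun /=.
have bf : bilinear_for *:%R *:%R (fun u v => x u * y v : (fps R)^o).
  split=> [v|u] a b c; rewrite linearP.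
    by rewrite mulrDl -mulrA.
  by rewrite mulrDr mulrCA.
have bg : bilinear_for *:%R *:%R
    (fun u v => dtens_fun x X u * dtens_fun y Y v).
  split=> [v|u] a b c; rewrite linearP.
    by rewrite mulrDl -scalerAl.
  by rewrite mulrDr -scalerAr.
pose G t := (ctlift (@htens _ H) (fun u v => x u * y v : (fps R)^o) t : fps R)
  *: (X * Y).
have linG : linear G.
  move=> a b c; rewrite /G linearP scalerDl; congr (_ + _).
  by rewrite -[a *: _]/(a * _) scalerA.
pose GL := GRing.isLinear.Build _ _ _ _ G linG.
pose GG : {linear hsq H -> H} := HB.pack G GL.
symmetry; apply: (@ctlift_unique _ _ _ _ _ _ _ GG) => //.
- exact: htens_ctensor.
- exact: halg_complete.
move=> u v; rewrite /= /G ctliftE //.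
- by rewrite /dtens_fun -scalerAl -scalerAr scalerA.
- exact: htens_ctensor.
- exact: fps_complete.
Qed.

Definition has_dt_sum (I : choiceType) (u : I -> dualtens) (t : dualtens) :=
  forall h, has_adic_sum (fun i => u i h) (t h).

Definition dt_summable (I : choiceType) (u : I -> dualtens) :=
  exists t, has_dt_sum u t.

Definition dt_sum (I : choiceType) (u : I -> dualtens) : dualtens :=
  choose_or (\0 : {linear H -> H}) (has_dt_sum u).

Definition dt_exp_term (x : dual) (X : H) (n : nat) : dualtens :=
  dtens (dual_exp x n) (fpsC (n`!%:R^-1) *: X ^+ n).

Definition dt_exp (x : dual) (X : H) : dualtens := dt_sum (dt_exp_term x X).

Definition dual_basis (I : choiceType) (X : I -> H) (x : I -> dual) : Prop :=
  forall i j, x i (X j) = (i == j)%:R.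

Definition Tmatrix_term (I : choiceType) (X : I -> H) (x : I -> dual) (i : I) :=
  dtens (x i) (X i).

Definition Tmatrix (I : choiceType) (X : I -> H) (x : I -> dual) : dualtens :=
  dt_sum (Tmatrix_term X x).

End Dual.

Section KappaPoincare.
Variables (R : comUnitRingType) (H : hopfAlgebra R).

Definition adic_exp (h : H) : H :=
  adic_sum (fun n : nat => fpsC (n`!%:R^-1) *: h ^+ n).

(* (e^(t h) - 1) / t as a power series in t *)
Definition adic_expm1_div (t : fps R) (h : H) : H :=
  adic_sum (fun n : nat => (fpsC (n.+1`!%:R^-1) * t ^+ n) *: h ^+ n.+1).

Lemma adic_expm1_divE (a : fps R) (h : H) :
  (omega * a) *: adic_expm1_div (omega * a) h = adic_exp ((omega * a) *: h) - 1.
Proof.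
have cH := halg_complete H.
pose v n : H := fpsC (n`!%:R^-1) *: ((omega * a) *: h) ^+ n.
pose u n : H := (fpsC (n.+1`!%:R^-1) * (omega * a) ^+ n) *: h ^+ n.+1.
have /(has_adic_sum_nat cH)/has_adic_sum_cvg vS n : adic n (v n).
  exists (fpsC (n`!%:R^-1) *: (a ^+ n *: h ^+ n)).
  by rewrite /v exprZn exprMn !scalerA mulrA mulrCA mulrA.
have /(has_adic_sum_nat cH)/has_adic_sum_cvg uS n : adic n (u n).
  exists ((fpsC (n.+1`!%:R^-1) * a ^+ n) *: h ^+ n.+1).
  by rewrite /u exprMn !scalerA mulrCA.
apply/eqP; rewrite eq_sym subr_eq; apply/eqP.
apply: (adic_cvg_unique cH vS) => n; have [N uN] := uS n.
exists N.+1 => -[//|i] le_Ni; rewrite big_ord_recl.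
have -> : v 0 = 1 by rewrite /v fact0 invr1 !expr0 scale1r.
have -> : \sum_(j < i) v (bump 0 j) = (omega * a) *: \sum_(j < i) u j.
  rewrite scaler_sumr; apply: eq_bigr => j _.
  by rewrite /u /v exprZn !scalerA mulrCA -exprS.
rewrite [1 + _]addrC opprD addrACA subrr addr0 -scalerBr.
exact/adicZ/uN.
Qed.

Definition bracket (X Y : H) : H := X * Y - Y * X.

Definition pbw (P0 P1 K : H) (i : nat * nat * nat) : H :=
  P0 ^+ i.1.1 * P1 ^+ i.1.2 * K ^+ i.2.

Record kappa_poincare (P0 P1 K : H) : Prop := KappaPoincare {
  kp_basis : topological_basis (pbw P0 P1 K);
  kp_P0P1 : bracket P0 P1 = 0;
  kp_KP0 : bracket K P0 = P1;
  kp_KP1 : bracket K P1 = adic_expm1_div (4 * omega) P0 + omega *: P1 ^+ 2;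
  kp_DP0 : coproduct H P0 = htens P0 1 + htens 1 P0;
  kp_DP1 : coproduct H P1 =
    htens P1 (adic_exp ((2 * omega) *: P0)) + htens 1 P1;
  kp_DK : coproduct H K =
    htens K (adic_exp ((2 * omega) *: P0)) + htens 1 K
}.

End KappaPoincare.

(* Main.v *)
(* T is the canonical element of the dual pair, hence acts on H as the identity,
   and the product of H^* (x) H is the convolution of endomorphisms of H. From
   the coproducts one gets a0^n = n! x_(n00), a1^n = n! x_(0n0) and
   chi^n = n! x_(00n), so the three exponentials are the projections of H onto
   the closed spans of the P0^n, of the P1^n and of the K^n. The convolution of
   the three commutes with left multiplication by P0 and P1 and with right
   multiplication by K, because every unwanted term of a coproduct is killed by
   one of the projections; it also fixes 1, so it is the identity. The only
   delicate point is chi^n, where Delta(K)^k produces factors e^(2 w P0) to the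
   right of powers of K: x_(00n) kills H P0, as x_(00n)(K h) = x_(00n)(h K). *)
From HB Require Import structures.
Require Import Defs.
From mathcomp Require Import all_boot all_order all_algebra.
From mathcomp Require Import finmap boolp reals.

Set Implicit Arguments.
Unset Strict Implicit.
Unset Printing Implicit Defensive.

Import GRing.Theory Num.Theory.
Local Open Scope ring_scope.

(** * Adic sums, completed tensor products and topological bases *)

Section AdicSums.
Variable R : comNzRingType.

Lemma adic_linear (M N : lmodType (fps R)) (f : {linear M -> N}) n m :
  adic n m -> adic n (f m).
Proof. by move=> [m' ->]; exists (f m'); rewrite linearZ. Qed.

Lemma has_adic_sum_linear (M N : lmodType (fps R)) (f : {linear M -> N})
    (I : choiceType) (u : I -> M) s :
  has_adic_sum u s -> has_adic_sum (fun i => f (u i)) (f s).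
Proof.
move=> us n; have [F0 sF] := us n; exists F0 => F /sF/(adic_linear f).
by rewrite linearB linear_sum.
Qed.

Lemma has_adic_sum_delta (M : lmodType (fps R)) (I : choiceType) (u : I -> M)
    i0 :
  (forall i, i != i0 -> u i = 0) -> has_adic_sum u (u i0).
Proof.
move=> u0 n; exists [fset i0]%fset => F; rewrite fsub1set => i0F.
rewrite (bigD1_seq i0) ?fset_uniq //= big1 ?addr0 ?subrr //.
exact: adic0.
Qed.

Lemma adic_sum_seq (M : lmodType (fps R)) (I : eqType) (u : I -> M) n
    (r : seq I) (P : pred I) :
  (forall i, i \in r -> P i -> adic n (u i)) ->
  adic n (\sum_(i <- r | P i) u i).
Proof.
move=> un; rewrite big_seq_cond; elim/big_ind: _ => [|x y|i /andP[]].
- exact: adic0.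
- exact: adicD.
- exact: un.
Qed.

(** Modulo w^n, enlarging a finite set that contains [F n] does not change the partial sum, so
    completeness supplies the limit. *)
Lemma null_has_adic_sum (M : lmodType (fps R)) (I : choiceType)
    (c : I -> fps R) (e : I -> M) :
  adic_complete M -> null_family c ->
  exists s, has_adic_sum (fun i => c i *: e i) s.
Proof.
move=> cM /choice[F Fc]; pose u i := c i *: e i.
have un n i : i \notin F n -> adic n (u i).
  by move=> /Fc[d cd]; exists (d *: e i); rewrite /u cd scalerA.
have diff n (G G' : {fset I}) : (F n `<=` G)%fset -> (G `<=` G')%fset ->
    adic n (\sum_(i <- G') u i - \sum_(i <- G) u i).
  move=> FG GG'; rewrite (big_fsetID _ (mem G)) /=.
  have -> : [fset i in G' | i \in G]%fset = G.
    apply/fsetP => i; rewrite !inE /= andbC.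
    by case iG: (i \in G) => //=; apply: (fsubsetP GG').
  rewrite addrAC subrr add0r.
  apply: adic_sum_seq => i; rewrite !inE /= => /andP[_ iG] _; apply: un.
  by apply: contra iG; apply: (fsubsetP FG).
(* [G i] contains [F n] for every i >= n, so the sums over the [G i] form a Cauchy sequence;
   unordered convergence then follows by comparing any larger set with one [G i]. *)
pose G n := (\bigcup_(k <- iota 0 n.+1) F k)%fset.
have FG n k : (k <= n)%N -> (F k `<=` G n)%fset.
  by move=> le_kn; apply: bigfcup_sup => //; rewrite mem_iota.
have [|s us] := cM.2 (fun n => \sum_(i <- G n) u i).
  move=> n; exists n => i j le_ni le_nj.
  rewrite -(subrKA (\sum_(k <- F n) u k)); apply: adicD.
    by apply: diff => //; apply: FG.
  by rewrite -opprB; apply/adicN/diff => //; apply: FG.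
exists s => n; have [N sN] := us n.
exists (G (maxn n N)) => A GA.
rewrite -(subrKA (\sum_(i <- G (maxn n N)) u i)); apply: adicD.
  by apply: diff => //; apply/FG/leq_maxl.
exact/sN/leq_maxr.
Qed.

Lemma eq_has_adic_sum (M : lmodType (fps R)) (I : choiceType) (u v : I -> M) s :
  u =1 v -> has_adic_sum u s -> has_adic_sum v s.
Proof. by move=> /funext ->. Qed.

(** The uniqueness half of the universal property, for plain functions with a proof of linearity, so
    that composites such as multiplication by a fixed element need no bundling. *)
Lemma ctensor_ext (M N T P : lmodType (fps R)) (t : M -> N -> T)
    (f g : T -> P) :
  is_ctensor t -> adic_complete P -> linear f -> linear g ->
  (forall u v, f (t u v) = g (t u v)) -> f =1 g.
Proof.
move=> [[tl tr] _ ut] cP lf lg fg.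
pose F : {linear T -> P} := HB.pack f (GRing.isLinear.Build _ _ _ _ f lf).
pose G : {linear T -> P} := HB.pack g (GRing.isLinear.Build _ _ _ _ g lg).
have bF : bilinear_for *:%R *:%R (fun u v => F (t u v)).
  by split=> [v|u] a b c /=; rewrite (tl, tr) /= lf.
have [L [_ uL]] := ut P _ cP bF.
by move=> x; rewrite -[f x]/(F x) -[g x]/(G x) !uL.
Qed.

(** Linear maps are automatically w-adically continuous, so they can be evaluated term by term on
    the expansion of [h]. *)
Lemma topological_basis_ext (M N : lmodType (fps R)) (I : choiceType)
    (e : I -> M) (f g : {linear M -> N}) :
  topological_basis e -> adic_complete N ->
  (forall i, f (e i) = g (e i)) -> f =1 g.
Proof.
move=> be cN fg h; have [c [[_ ch] _]] := be h.
apply: (has_adic_sum_unique cN (has_adic_sum_linear f ch)).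
apply: eq_has_adic_sum (has_adic_sum_linear g ch) => i.
by rewrite !linearZ fg.
Qed.

(** Applying [x i] term by term to the expansion of [h] leaves only its i-th coefficient. *)
Lemma topological_basis_coord (M : lmodType (fps R)) (I : choiceType)
    (e : I -> M) (x : I -> {linear M -> (fps R)^o}) h :
  topological_basis e -> (forall i j, x i (e j) = (i == j)%:R) ->
  null_family (fun i => x i h) /\ has_adic_sum (fun i => x i h *: e i) h.
Proof.
move=> be xe; have [c [[nc ch] _]] := be h.
suff xc i : x i h = c i.
  by split; [rewrite (funext xc)|apply: eq_has_adic_sum ch => i; rewrite xc].
apply: (has_adic_sum_unique (@fps_complete R) (has_adic_sum_linear (x i) ch)).
have -> : c i = x i (c i *: e i) :> (fps R)^o.
  by rewrite linearZ xe eqxx -[RHS]/(c i * 1) mulr1.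
apply: (@has_adic_sum_delta _ _ (fun j => x i (c j *: e j)) i) => j /negPf ne_ji.
by rewrite linearZ xe eq_sym ne_ji -[LHS]/(c j * 0) mulr0.
Qed.

Lemma null_family_comp (I J : choiceType) (c : I -> fps R) (f : J -> I)
    (g : I -> J) :
  cancel f g -> null_family c -> null_family (c \o f).
Proof.
move=> fK nc n; have [F cF] := nc n; exists [fset g i | i in F]%fset => j jF.
by apply: cF; apply: contra jF => fjF; rewrite -[j]fK in_imfset.
Qed.

End AdicSums.

(** * Convolution of linear maps from H to a complete algebra *)

Section Convolution.
Variables (R : comNzRingType) (H : hopfAlgebra R) (A : algType (fps R)).
Hypothesis cA : adic_complete A.
Implicit Types s t : {linear H -> A}.

Definition conv s t : {linear hsq H -> A} :=
  ctlift (@htens _ H) (fun u v => s u * t v).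

Lemma convE s t u v : conv s t (htens u v) = s u * t v.
Proof.
apply: ctliftE cA _ u v; first exact: htens_ctensor.
split=> [v|u] a b c; rewrite linearP; first by rewrite mulrDl -scalerAl.
by rewrite mulrDr -scalerAr.
Qed.

Lemma conv_ext s t (f : {linear hsq H -> A}) :
  (forall u v, f (htens u v) = s u * t v) -> conv s t =1 f.
Proof.
move=> fE; apply: (ctensor_ext (@htens_ctensor _ H) cA); try exact: linearP.
by move=> u v; rewrite convE fE.
Qed.

(** Both sides are linear in [z], so pure tensors suffice, where the product is taken factor by
    factor. This lemma and its variants reduce statements about the coproduct of a product with a
    generator to identities between values of [s] and [t]. *)
Lemma conv_mull s t s' t' (a b : H) (c : A) :
  (forall u v, s (a * u) * t (b * v) = c * (s' u * t' v)) ->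
  forall z, conv s t (htens a b * z) = c * conv s' t' z.
Proof.
move=> st; apply: (ctensor_ext (@htens_ctensor _ H) cA).
- by move=> k y z; rewrite mulrDr -scalerAr linearP.
- by move=> k y z; rewrite linearP mulrDr -scalerAr.
by move=> u v; rewrite htensM !convE.
Qed.

Lemma conv_mulr s t s' t' (a b : H) (c : A) :
  (forall u v, s (u * a) * t (v * b) = s' u * t' v * c) ->
  forall z, conv s t (z * htens a b) = conv s' t' z * c.
Proof.
move=> st; apply: (ctensor_ext (@htens_ctensor _ H) cA).
- by move=> k y z; rewrite mulrDl -scalerAl linearP.
- by move=> k y z; rewrite linearP mulrDl -scalerAl.
by move=> u v; rewrite htensM !convE.
Qed.

Lemma conv_mull1 s t s' t' (a b : H) :
  (forall u v, s (a * u) * t (b * v) = s' u * t' v) ->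
  forall z, conv s t (htens a b * z) = conv s' t' z.
Proof.
move=> st z; rewrite (@conv_mull s t s' t' a b 1) ?mul1r // => u v.
by rewrite st mul1r.
Qed.

Lemma conv_mulr1 s t s' t' (a b : H) :
  (forall u v, s (u * a) * t (v * b) = s' u * t' v) ->
  forall z, conv s t (z * htens a b) = conv s' t' z.
Proof.
move=> st z; rewrite (@conv_mulr s t s' t' a b 1) ?mulr1 // => u v.
by rewrite st mulr1.
Qed.

Lemma conv_mull0 s t (a b : H) :
  (forall u v, s (a * u) * t (b * v) = 0) ->
  forall z, conv s t (htens a b * z) = 0.
Proof.
move=> st z; rewrite (@conv_mull s t s t _ _ 0) ?mul0r // => u v.
by rewrite st mul0r.
Qed.

Lemma conv_mulr0 s t (a b : H) :
  (forall u v, s (u * a) * t (v * b) = 0) ->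
  forall z, conv s t (z * htens a b) = 0.
Proof.
move=> st z; rewrite (@conv_mulr s t s t _ _ 0) ?mulr0 // => u v.
by rewrite st mulr0.
Qed.

End Convolution.

(** * The algebra H^* and divided powers in it *)

Section DualAlgebra.
Variables (R : comUnitRingType) (H : hopfAlgebra R).
Implicit Types x y : dual H.

Lemma dual_mulE x y h : dual_mul x y h = conv x y (coproduct H h).
Proof. by []. Qed.

Lemma dt_mulE (s t : dualtens H) h : dt_mul s t h = conv s t (coproduct H h).
Proof. by []. Qed.

Let counit_scale_bilinear :
  bilinear_for *:%R *:%R (fun u v : H => (counit H v : fps R) *: u).
Proof.
split=> [v|u] a b c /=; first by rewrite scalerDr !scalerA mulrC.
rewrite linearP scalerDl; congr (_ + _).
exact: esym (scalerA a (counit H b : fps R) u).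
Qed.

Lemma counit_rightE u v :
  ctlift (@htens _ H) (fun u v => counit H v *: u) (htens u v) =
  (counit H v : fps R) *: u.
Proof.
exact: ctliftE (htens_ctensor H) (halg_complete H) counit_scale_bilinear u v.
Qed.

Lemma counit_leftE u v :
  ctlift (@htens _ H) (fun u v => counit H u *: v) (htens u v) =
  (counit H u : fps R) *: v.
Proof.
apply: ctliftE (htens_ctensor H) (halg_complete H) _ u v.
by case: counit_scale_bilinear.
Qed.

Lemma dual_mul1 x : dual_mul x (dual_one H) = x.
Proof.
apply: linear_ext => h; rewrite dual_mulE -[in RHS](counitr h).
apply: (conv_ext (@fps_complete R) (f := x \o _)) => u v /=.
by rewrite counit_rightE linearZ /= -[LHS]/(counit H v * x u) mulrC.
Qed.

Lemma dual_1mul x : dual_mul (dual_one H) x = x.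
Proof.
apply: linear_ext => h; rewrite dual_mulE -[in RHS](counitl h).
apply: (conv_ext (@fps_complete R) (f := x \o _)) => u v /=.
by rewrite counit_leftE linearZ.
Qed.

Lemma dual_expS x n : dual_exp x n.+1 = dual_mul x (dual_exp x n).
Proof. by []. Qed.

Lemma dual_mul_natr x y y' n :
  (forall h, y h = n%:R * y' h) ->
  forall h, dual_mul x y h = n%:R * dual_mul x y' h.
Proof.
(* Inserting the factor 1 (x) 1 makes [conv_mull] applicable with a = b = 1. *)
move=> yy' h; rewrite !dual_mulE -[coproduct H h]mul1r -htens1.
rewrite (conv_mull (@fps_complete R) (s' := x) (t' := y') (c := n%:R)).
  by rewrite htens1 mul1r.
by move=> u v; rewrite !mul1r yy' mulrCA.
Qed.

(** Divided powers, with [d] a multiplication by one generator. By induction y_1 y_n = (n+1)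
    y_(n+1): on the image of [d] the Leibniz-type third hypothesis gives y_(n+1) + (n+1) y_(n+1) =
    (n+2) y_(n+1), and the last hypothesis extends the identity from that image to all of H. *)
Lemma dual_exp_divided (y : nat -> dual H) (d : H -> H) :
  y 0%N = dual_one H ->
  (forall n h, y n.+1 (d h) = y n h) ->
  (forall n h, dual_mul (y 1%N) (y n.+1) (d h) =
     y n.+1 h + dual_mul (y 1%N) (y n) h) ->
  (forall n (c : fps R),
     (forall h, dual_mul (y 1%N) (y n.+1) (d h) = c * y n.+2 (d h)) ->
     forall h, dual_mul (y 1%N) (y n.+1) h = c * y n.+2 h) ->
  forall n h, dual_exp (y 1%N) n h = n`!%:R * y n h.
Proof.
move=> y0 yS y1S ext.
have y1M n h : dual_mul (y 1%N) (y n) h = n.+1%:R * y n.+1 h.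
  elim: n h => [|n IHn]; first by move=> h; rewrite y0 dual_mul1 mul1r.
  by apply: ext => h; rewrite y1S IHn yS [n.+2%:R]mulrSr mulrDl mul1r addrC.
elim=> [|n IHn] h; first by rewrite y0 mul1r.
by rewrite dual_expS (dual_mul_natr _ IHn) y1M mulrA -natrM mulnC -factS.
Qed.

End DualAlgebra.

(** * Infinite sums in the completed tensor product of H^* and H *)

Section DualTensorSums.
Variables (R : comUnitRingType) (H : hopfAlgebra R).

(** The pointwise sums are picked by choice; uniqueness of sums makes the resulting map linear. *)
Lemma dt_summable_pointwise (I : choiceType) (u : I -> dualtens H) :
  (forall h, exists s, has_adic_sum (fun i => u i h) s) -> dt_summable u.
Proof.
move=> /choice[t ut]; have cH := halg_complete H.
have lt : linear t.
  move=> a h k; apply: (has_adic_sum_unique cH (ut _)) => n.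
  have [F tF] := ut h n; have [G tG] := ut k n.
  exists (F `|` G)%fset => A; rewrite fsubUset => /andP[FA GA].
  have -> : \sum_(i <- A) u i (a *: h + k) - (a *: t h + t k) =
      a *: (\sum_(i <- A) u i h - t h) + (\sum_(i <- A) u i k - t k).
    rewrite scalerBr addrACA -opprD scaler_sumr -big_split /=; congr (_ - _).
    by apply: eq_bigr => i _; rewrite linearP.
  by apply: adicD; [apply/adicZ/tF|apply: tG].
exists (HB.pack t (GRing.isLinear.Build _ _ _ _ t lt) : {linear H -> H}).
exact: ut.
Qed.

Lemma dt_sumP (I : choiceType) (u : I -> dualtens H) :
  dt_summable u -> has_dt_sum u (dt_sum u).
Proof. exact: (@choose_orP _ _ (has_dt_sum u)). Qed.

Lemma dt_sumE (I : choiceType) (u : I -> dualtens H) t :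
  has_dt_sum u t -> dt_sum u = t.
Proof.
move=> ut; apply: linear_ext => h.
apply: (has_adic_sum_unique (halg_complete H) _ (ut h)).
by apply: dt_sumP; exists t.
Qed.

(** Evaluated at h, the canonical element is the expansion of h in the basis. *)
Lemma has_dt_sum_Tmatrix (I : choiceType) (X : I -> H) (x : I -> dual H) :
  topological_basis X -> dual_basis X x ->
  has_dt_sum (Tmatrix_term X x) (idfun : {linear H -> H}).
Proof. by move=> bX dx h; case: (topological_basis_coord h bX dx). Qed.

End DualTensorSums.

Lemma fpsC_natr (R : comNzRingType) n : n%:R = fpsC n%:R :> fps R.
Proof.
elim: n => [|n IHn]; first by apply: fpsP => i /=; case: ifP.
rewrite -[n.+1]addn1 !natrD IHn; apply: fpsP => i /=.
by case: ifP; rewrite ?addr0.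
Qed.

Lemma fpsC_fact_inv (R : numFieldType) n :
  n`!%:R * fpsC (n`!%:R^-1) = 1 :> fps R.
Proof.
rewrite fpsC_natr; apply: fpsP => i /=.
rewrite big_ord_recl subn0 big1 ?addr0 /= => [|j _]; last by rewrite mul0r.
case: ifP => _; last by rewrite mulr0.
by rewrite mulfV // pnatr_eq0 -lt0n fact_gt0.
Qed.

(** * Exponentials as projections onto the closed span of the powers of X *)

Section DualExponential.
Variables (R : numFieldType) (H : hopfAlgebra R) (I : choiceType).
Variables (e : I -> H) (x : I -> dual H) (f : nat -> I) (g : I -> nat).
Hypotheses (be : topological_basis e) (dx : dual_basis e x) (fK : cancel f g).
Variables (a : dual H) (X : H).
Hypotheses (aE : forall n h, dual_exp a n h = n`!%:R * x (f n) h)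
  (XE : forall n, X ^+ n = e (f n)).

(** The factorial in a^n cancels the one in the exponential series, leaving the rank-one projection
    onto the basis vector X^n. *)
Let termE n h : dt_exp_term a X n h = x (f n) h *: e (f n).
Proof.
rewrite -XE -[LHS]/((dual_exp a n h : fps R) *: (fpsC (n`!%:R^-1) *: X ^+ n)).
by rewrite aE scalerA mulrAC fpsC_fact_inv mul1r.
Qed.

(** The coordinates of h tend to 0, also along the injective reindexing [f]. Since [dt_sum] defaults
    to 0 on families without a sum, the values of [dt_exp] found below rest on this. *)
Lemma dt_exp_summable : dt_summable (dt_exp_term a X).
Proof.
apply: dt_summable_pointwise => h.
have [nx _] := topological_basis_coord h be dx.
have [s xs] := null_has_adic_sum (e \o f) (halg_complete H)
  (null_family_comp fK nx).
by exists s; apply: eq_has_adic_sum xs => n; rewrite termE.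
Qed.

Let dt_expP h := dt_sumP dt_exp_summable h.

Lemma dt_exp_basis n : dt_exp a X (e (f n)) = e (f n).
Proof.
apply: (has_adic_sum_unique (halg_complete H) (dt_expP _)).
have {2}-> : e (f n) = dt_exp_term a X n (e (f n)).
  by rewrite termE dx eqxx scale1r.
apply: (has_adic_sum_delta (u := fun m => dt_exp_term a X m (e (f n)))).
move=> m /negPf ne_mn; rewrite termE dx.
by rewrite (inj_eq (can_inj fK)) ne_mn scale0r.
Qed.

Lemma dt_exp_basis0 i : (forall n, f n != i) -> dt_exp a X (e i) = 0.
Proof.
move=> ifn; apply: (has_adic_sum_unique (halg_complete H) (dt_expP _)).
have term0 m : dt_exp_term a X m (e i) = 0.
  by rewrite termE dx (negPf (ifn m)) scale0r.
(* All terms vanish; the sum 0 is written as the term of index 0 to fit [has_adic_sum_delta]. *)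
rewrite -(term0 0%N).
by apply: (has_adic_sum_delta (u := fun m => dt_exp_term a X m (e i))).
Qed.

End DualExponential.

(** * Linear maps applied to the exponential series of the deformation *)

Section AdicExp.
Variables (R : comUnitRingType) (H : hopfAlgebra R).

(** By continuity [F] acts term by term, and only the constant term 1 of the exponential
    survives. *)
Lemma linear_adic_exp (M : lmodType (fps R)) (F : H -> M) (a : fps R) (h : H) :
  adic_complete M -> linear F -> (forall n, F (h ^+ n.+1) = 0) ->
  F (adic_exp ((a * omega) *: h)) = F 1.
Proof.
move=> cM lF F0; set t := (a * omega) *: h.
pose L : {linear H -> M} := HB.pack F (GRing.isLinear.Build _ _ _ _ F lF).
pose u n : H := fpsC (n`!%:R^-1) *: t ^+ n.
(* The factor [omega] makes the n-th term divisible by w^n, whence convergence. *)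
have un n : adic n (u n).
  exists (fpsC (n`!%:R^-1) *: (a ^+ n *: h ^+ n)).
  by rewrite /u /t exprZn exprMn !scalerA [a ^+ n * _]mulrC mulrCA.
have uS := has_adic_sum_nat (halg_complete H) un.
apply: (has_adic_sum_unique cM (has_adic_sum_linear L uS)).
have -> : F 1 = L (u 0) by rewrite /u fact0 invr1 scale1r.
apply: (has_adic_sum_delta (u := fun n => L (u n))) => -[//|n] _.
by rewrite linearZ /t exprZn linearZ /= F0 !scaler0.
Qed.

Lemma linear_adic_expm1_div (M : lmodType (fps R)) (F : H -> M) (a : fps R)
    (h : H) :
  adic_complete M -> linear F -> (forall n, F (h ^+ n.+1) = 0) ->
  F (adic_expm1_div (a * omega) h) = 0.
Proof.
move=> cM lF F0; set t := a * omega.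
pose L : {linear H -> M} := HB.pack F (GRing.isLinear.Build _ _ _ _ F lF).
pose u n : H := (fpsC (n.+1`!%:R^-1) * t ^+ n) *: h ^+ n.+1.
have un n : adic n (u n).
  exists ((fpsC (n.+1`!%:R^-1) * a ^+ n) *: h ^+ n.+1).
  by rewrite /u /t exprMn !scalerA [a ^+ n * _]mulrC mulrCA.
have uS := has_adic_sum_nat (halg_complete H) un.
apply: (has_adic_sum_unique cM (has_adic_sum_linear L uS)).
have Lu n : L (u n) = 0 by rewrite linearZ /= F0 scaler0.
rewrite -(Lu 0%N).
by apply: (has_adic_sum_delta (u := fun n => L (u n))) => n _.
Qed.

End AdicExp.

(** * Commutation rules and the ordered basis *)

Section KappaPoincare.
Variables (R : numFieldType) (H : hopfAlgebra R) (P0 P1 K : H).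
Hypothesis kP : kappa_poincare P0 P1 K.
Variable x : nat * nat * nat -> dual H.
Hypothesis dx : dual_basis (pbw P0 P1 K) x.

Let e := pbw P0 P1 K.
Let be : topological_basis e := kp_basis kP.
Let cH : adic_complete H := halg_complete H.
Let cR : adic_complete (fps R)^o := @fps_complete R.
Let E : H := adic_exp ((2 * omega) *: P0).

Lemma commP0P1 : GRing.comm P1 P0.
Proof.
by apply/eqP; rewrite eq_sym -subr_eq0; apply/eqP; exact: kp_P0P1 kP.
Qed.

Lemma mulKP0 : K * P0 = P0 * K + P1.
Proof. by rewrite -(kp_KP0 kP) addrC subrK. Qed.

Lemma mulKP1 :
  K * P1 = P1 * K + (adic_expm1_div (4 * omega) P0 + omega *: P1 ^+ 2).
Proof. by rewrite -(kp_KP1 kP) addrC subrK. Qed.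

Lemma pbw_mulP0 a b c : P0 * e (a, b, c) = e (a.+1, b, c).
Proof. by rewrite /e /pbw /= exprS !mulrA. Qed.

Lemma pbw_mulP1 a b c : P1 * e (a, b, c) = e (a, b.+1, c).
Proof.
by rewrite /e /pbw /= !mulrA (commrX a commP0P1) -[_ * P1 * _]mulrA -exprS.
Qed.

Lemma pbw_mulK a b c : e (a, b, c) * K = e (a, b, c.+1).
Proof. by rewrite /e /pbw /= exprSr !mulrA. Qed.

Lemma pbw1 : e (0, 0, 0)%N = 1.
Proof. by rewrite /e /pbw /= !mul1r. Qed.

(* P0^a P1^b K^c is built from 1 by multiplying by K on the right, then by P1
   and P0 on the left. *)
Lemma pbw_ext (M : lmodType (fps R)) (f g : {linear H -> M}) :
  adic_complete M -> f 1 = g 1 ->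
  (forall h, f h = g h -> f (P0 * h) = g (P0 * h)) ->
  (forall h, f h = g h -> f (P1 * h) = g (P1 * h)) ->
  (forall h, f h = g h -> f (h * K) = g (h * K)) ->
  f =1 g.
Proof.
move=> cM fg1 fgP0 fgP1 fgK; apply: (topological_basis_ext be cM) => -[[a b] c].
elim: a => [|a IHa]; last by rewrite -pbw_mulP0 fgP0.
elim: b => [|b IHb]; last by rewrite -pbw_mulP1 fgP1.
by elim: c => [|c IHc]; [rewrite pbw1|rewrite -pbw_mulK fgK].
Qed.

(** * Dual coordinates under multiplication by generators *)

Lemma coord_shift (L : {linear H -> H}) phi i h :
  (forall j, L (e j) = e (phi j)) -> injective phi ->
  x (phi i) (L h) = x i h.
Proof.
move=> Le phiI.
apply: (topological_basis_ext (f := x (phi i) \o L) be cR) => j /=.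
by rewrite Le !dx (inj_eq phiI).
Qed.

Lemma coord_shift0 (L : {linear H -> H}) phi i h :
  (forall j, L (e j) = e (phi j)) -> (forall j, i != phi j) -> x i (L h) = 0.
Proof.
move=> Le iphi.
apply: (topological_basis_ext (f := x i \o L) (g := \0) be cR) => j /=.
by rewrite Le dx (negPf (iphi j)).
Qed.

Lemma coord_mulP0 a b c h : x (a.+1, b, c) (P0 * h) = x (a, b, c) h.
Proof.
apply: (@coord_shift (P0 \*o idfun) (fun j => (j.1.1.+1, j.1.2, j.2)) (a, b, c)).
  by case=> [[a' b'] c']; rewrite /= pbw_mulP0.
by move=> [[? ?] ?] [[? ?] ?] [-> -> ->].
Qed.

Lemma coord_mulP00 b c h : x (0%N, b, c) (P0 * h) = 0.
Proof.
apply: (@coord_shift0 (P0 \*o idfun) (fun j => (j.1.1.+1, j.1.2, j.2))) => //.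
by case=> [[a' b'] c']; rewrite /= pbw_mulP0.
Qed.

Lemma coord_mulP1 a b c h : x (a, b.+1, c) (P1 * h) = x (a, b, c) h.
Proof.
apply: (@coord_shift (P1 \*o idfun) (fun j => (j.1.1, j.1.2.+1, j.2)) (a, b, c)).
  by case=> [[a' b'] c']; rewrite /= pbw_mulP1.
by move=> [[? ?] ?] [[? ?] ?] [-> -> ->].
Qed.

Lemma coord_mulP10 a c h : x (a, 0%N, c) (P1 * h) = 0.
Proof.
apply: (@coord_shift0 (P1 \*o idfun) (fun j => (j.1.1, j.1.2.+1, j.2))).
  by case=> [[a' b'] c']; rewrite /= pbw_mulP1.
by move=> j; rewrite !xpair_eqE andbF.
Qed.

Lemma coord_mulK a b c h : x (a, b, c.+1) (h * K) = x (a, b, c) h.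
Proof.
apply: (@coord_shift (K \o* idfun) (fun j => (j.1.1, j.1.2, j.2.+1)) (a, b, c)).
  by case=> [[a' b'] c']; rewrite /= pbw_mulK.
by move=> [[? ?] ?] [[? ?] ?] [-> -> ->].
Qed.

Lemma coord_mulK0 a b h : x (a, b, 0%N) (h * K) = 0.
Proof.
apply: (@coord_shift0 (K \o* idfun) (fun j => (j.1.1, j.1.2, j.2.+1))).
  by case=> [[a' b'] c']; rewrite /= pbw_mulK.
by move=> j; rewrite !xpair_eqE andbF.
Qed.

Lemma coord1 i : x i 1 = (i == (0, 0, 0)%N)%:R.
Proof. by rewrite -pbw1 dx. Qed.

(** Every term of [E] except 1 starts with P0 and is killed by [coord_mulP00]. *)
Lemma coord_expP0 b c h : x (0%N, b, c) (E * h) = x (0%N, b, c) h.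
Proof.
pose F : {linear H -> (fps R)^o} := x (0%N, b, c) \o (h \o* idfun).
rewrite -[LHS]/(F E) (linear_adic_exp _ cR (F := F)) /= ?mul1r //.
  exact: linearP.
by move=> n; rewrite /= exprS -mulrA coord_mulP00.
Qed.

(** The counit axiom reads counit(g) k + g = g, so counit(g) k = 0; the constant coordinate of [k]
    is 1. *)
Lemma counit_skew_primitive g k :
  coproduct H g = htens g k + htens 1 g -> x (0, 0, 0)%N k = 1 ->
  counit H g = 0.
Proof.
move=> Dg k1; have := counitl g.
rewrite Dg linearD /= !counit_leftE rmorph1 scale1r => /(congr1 (+%R^~ (- g))).
rewrite addrK subrr => /(congr1 (x (0, 0, 0)%N)).
by rewrite linearZ linear0 /= k1 -[LHS]/(counit H g * 1) mulr1.
Qed.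

(** Both functionals are 1 at 1 and vanish on P0 H, P1 H and H K. In particular x_(000) is
    multiplicative. *)
Lemma coord_counit : x (0, 0, 0)%N = dual_one H.
Proof.
apply: linear_ext => h; apply: esym; move: h.
have xE : x (0, 0, 0)%N E = 1 by rewrite -[E]mulr1 coord_expP0 coord1.
apply: pbw_ext => // [|h _|h _|h _].
- by rewrite rmorph1 coord1.
- rewrite rmorphM /= (counit_skew_primitive (kp_DP0 kP)) ?coord1 //.
  by rewrite mul0r coord_mulP00.
- rewrite rmorphM /= (counit_skew_primitive (kp_DP1 kP)) //.
  by rewrite mul0r coord_mulP10.
- rewrite rmorphM /= (counit_skew_primitive (kp_DK kP)) //.
  by rewrite mulr0 coord_mulK0.
Qed.

Lemma coord000M h k :
  x (0, 0, 0)%N (h * k) = x (0, 0, 0)%N h * x (0, 0, 0)%N k.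
Proof. by rewrite coord_counit; apply: rmorphM. Qed.

(** Moving K to the right past P0 or P1 only creates terms that still begin with P0 or P1, and these
    are invisible to x_(00m). *)
Lemma coord_mulKl n h : x (0, 0, n.+1)%N (K * h) = x (0, 0, n)%N h.
Proof.
have xKP0 m k : x (0, 0, m)%N (K * (P0 * k)) = 0.
  by rewrite mulrA mulKP0 mulrDl -!mulrA linearD /= coord_mulP00 coord_mulP10
    addr0.
have xKP1 m k : x (0, 0, m)%N (K * (P1 * k)) = 0.
  (* [F] kills all positive powers of P0, hence the power series in P0 occurring in [K, P1]. *)
  pose F : {linear H -> (fps R)^o} := x (0, 0, m)%N \o (k \o* idfun).
  have : F (adic_expm1_div (4 * omega) P0) = 0.
    apply: linear_adic_expm1_div cR _ _; first exact: linearP.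
    by move=> i; rewrite /= exprS -mulrA coord_mulP00.
  rewrite mulrA mulKP1 /=; set Q := adic_expm1_div _ _ => FQ.
  rewrite !mulrDl -scalerAl -!mulrA !linearD linearZ /= FQ.
  by rewrite !coord_mulP10 scaler0 !addr0.
(* Needed to start the induction: x_(001)(K h K) equals x_(000)(K h), which has to vanish as
   x_(000)(h K) does. *)
have xK0 k : x (0, 0, 0)%N (K * k) = 0.
  move: k; apply: (pbw_ext (f := x _ \o (K \*o idfun)) (g := \0)) => //=.
  - by rewrite mulr1 -[K]mul1r coord_mulK0.
  - by move=> k _; rewrite mulrA coord_mulK0.
elim: n h => [|n IHn];
  apply: (pbw_ext (f := x _ \o (K \*o idfun))) => //= [|h _|h _|h _].
- by rewrite mulr1 -[K]mul1r coord_mulK coord1.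
- by rewrite xKP0 coord_mulP00.
- by rewrite xKP1 coord_mulP10.
- by rewrite mulrA coord_mulK xK0 coord_mulK0.
- by rewrite mulr1 -[K]mul1r coord_mulK !coord1.
- by rewrite xKP0 coord_mulP00.
- by rewrite xKP1 coord_mulP10.
- by rewrite mulrA !coord_mulK IHn.
Qed.

(** Only h = K^c needs work. Each K on the left is stripped by [coord_mulKl], or by multiplicativity
    of x_(000) once the index has reached 0, until P0 stands alone. *)
Lemma coord_mulP0r n h : x (0, 0, n)%N (h * P0) = 0.
Proof.
have xKP0 c m : x (0, 0, m)%N (K ^+ c * P0) = 0.
  elim: c m => [|c IHc] [|m].
  - by rewrite mul1r -[P0]mulr1 coord_mulP00.
  - by rewrite mul1r -[P0]mulr1 coord_mulP00.
  - by rewrite exprS -mulrA coord000M IHc mulr0.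
  - by rewrite exprS -mulrA coord_mulKl IHc.
move: h; apply: (topological_basis_ext (f := x _ \o (P0 \o* idfun))
  (g := \0) be cR) => -[[[|a] [|b]] c] /=.
- by rewrite /e /pbw /= !mul1r xKP0.
- by rewrite -pbw_mulP1 -mulrA coord_mulP10.
- by rewrite -pbw_mulP0 -mulrA coord_mulP00.
- by rewrite -pbw_mulP0 -mulrA coord_mulP00.
Qed.

Lemma coord_expP0r n h : x (0, 0, n)%N (h * E) = x (0, 0, n)%N h.
Proof.
pose F : {linear H -> (fps R)^o} := x (0, 0, n)%N \o (h \*o idfun).
rewrite -[LHS]/(F E) (linear_adic_exp _ cR (F := F)) /= ?mulr1 //.
  exact: linearP.
by move=> m; rewrite /= exprSr mulrA coord_mulP0r.
Qed.

(** * Convolutions evaluated on products with a generator *)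

Section ConvCoproduct.
Variables (A : algType (fps R)) (s t : {linear H -> A}).

Lemma conv_coproductP0 h :
  conv s t (coproduct H (P0 * h)) =
  conv s t (htens P0 1 * coproduct H h) + conv s t (htens 1 P0 * coproduct H h).
Proof. by rewrite rmorphM /= (kp_DP0 kP) mulrDl linearD. Qed.

Lemma conv_coproductP1 h :
  conv s t (coproduct H (P1 * h)) =
  conv s t (htens P1 E * coproduct H h) + conv s t (htens 1 P1 * coproduct H h).
Proof. by rewrite rmorphM /= (kp_DP1 kP) mulrDl linearD. Qed.

Lemma conv_coproductK h :
  conv s t (coproduct H (h * K)) =
  conv s t (coproduct H h * htens K E) + conv s t (coproduct H h * htens 1 K).
Proof. by rewrite rmorphM /= (kp_DK kP) mulrDr linearD. Qed.

Lemma conv_coproduct1 : adic_complete A ->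
  conv s t (coproduct H 1) = s 1 * t 1.
Proof. by move=> cA; rewrite rmorph1 -htens1 convE. Qed.

End ConvCoproduct.

(** * Powers of the dual generators *)

Lemma dual_exp_P0 n h :
  dual_exp (x (1, 0, 0)%N) n h = n`!%:R * x (n, 0, 0)%N h.
Proof.
apply: (dual_exp_divided (y := fun n => x (n, 0, 0)%N) (d := *%R P0)).
- exact: coord_counit.
- by move=> m k; apply: coord_mulP0.
- move=> m k; rewrite dual_mulE conv_coproductP0; congr (_ + _).
    (* The summand P0 (x) 1 lowers x_(100) to x_(000), the unit of H^*. *)
    transitivity (dual_mul (dual_one H) (x (m.+1, 0, 0)%N) k).
      rewrite -coord_counit; apply: (conv_mull1 cR) => u v.
      by rewrite coord_mulP0 mul1r.
    by rewrite dual_1mul.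
  by apply: (conv_mull1 cR) => u v; rewrite mul1r coord_mulP0.
(* Agreement on P0 H is enough: at 1, on P1 H and on H K both sides vanish. *)
- move=> m c xd k.
  apply: (pbw_ext (f := dual_mul _ _) (g := c \*: x _)) =>
    [||h' _|h' _|h' _]; first exact: cR.
  + by rewrite dual_mulE conv_coproduct1 //= !coord1 mul0r scaler0.
  + exact: xd.
  + rewrite dual_mulE conv_coproductP1 /= coord_mulP10 scaler0.
    rewrite !(conv_mull0 cR) ?addr0 // => u v.
      by rewrite coord_mulP10 mulr0.
    by rewrite coord_mulP10 mul0r.
  + rewrite dual_mulE conv_coproductK /= coord_mulK0 scaler0.
    rewrite !(conv_mulr0 cR) ?addr0 // => u v.
      by rewrite coord_mulK0 mulr0.
    by rewrite coord_mulK0 mul0r.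
Qed.

Lemma dual_exp_P1 n h :
  dual_exp (x (0, 1, 0)%N) n h = n`!%:R * x (0, n, 0)%N h.
Proof.
apply: (dual_exp_divided (y := fun n => x (0, n, 0)%N) (d := *%R P1)).
- exact: coord_counit.
- by move=> m k; apply: coord_mulP1.
- move=> m k; rewrite dual_mulE conv_coproductP1; congr (_ + _).
    (* The factor [E] of Delta(P1) acts from the left and is absorbed by [coord_expP0]. *)
    transitivity (dual_mul (dual_one H) (x (0, m.+1, 0)%N) k).
      rewrite -coord_counit; apply: (conv_mull1 cR) => u v.
      by rewrite coord_mulP1 coord_expP0.
    by rewrite dual_1mul.
  by apply: (conv_mull1 cR) => u v; rewrite mul1r coord_mulP1.
- move=> m c xd k.
  apply: (pbw_ext (f := dual_mul _ _) (g := c \*: x _)) =>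
    [||h' _|h' _|h' _]; first exact: cR.
  + by rewrite dual_mulE conv_coproduct1 //= !coord1 mul0r scaler0.
  + rewrite dual_mulE conv_coproductP0 /= coord_mulP00 scaler0.
    rewrite !(conv_mull0 cR) ?addr0 // => u v.
      by rewrite coord_mulP00 mulr0.
    by rewrite coord_mulP00 mul0r.
  + exact: xd.
  + rewrite dual_mulE conv_coproductK /= coord_mulK0 scaler0.
    rewrite !(conv_mulr0 cR) ?addr0 // => u v.
      by rewrite coord_mulK0 mulr0.
    by rewrite coord_mulK0 mul0r.
Qed.

Lemma dual_exp_K n h :
  dual_exp (x (0, 0, 1)%N) n h = n`!%:R * x (0, 0, n)%N h.
Proof.
apply: (dual_exp_divided (y := fun n => x (0, 0, n)%N) (d := *%R^~ K)).
- exact: coord_counit.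
- by move=> m k; apply: coord_mulK.
- move=> m k; rewrite dual_mulE conv_coproductK; congr (_ + _).
    (* Here [E] stands on the right, so [coord_expP0r] is what absorbs it. *)
    transitivity (dual_mul (dual_one H) (x (0, 0, m.+1)%N) k).
      rewrite -coord_counit; apply: (conv_mulr1 cR) => u v.
      by rewrite coord_mulK coord_expP0r.
    by rewrite dual_1mul.
  by apply: (conv_mulr1 cR) => u v; rewrite mulr1 coord_mulK.
- move=> m c xd k.
  apply: (pbw_ext (f := dual_mul _ _) (g := c \*: x _)) =>
    [||h' _|h' _|h' _]; first exact: cR.
  + by rewrite dual_mulE conv_coproduct1 //= !coord1 mul0r scaler0.
  + rewrite dual_mulE conv_coproductP0 /= coord_mulP00 scaler0.
    rewrite !(conv_mull0 cR) ?addr0 // => u v.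
      by rewrite coord_mulP00 mulr0.
    by rewrite coord_mulP00 mul0r.
  + rewrite dual_mulE conv_coproductP1 /= coord_mulP10 scaler0.
    rewrite !(conv_mull0 cR) ?addr0 // => u v.
      by rewrite coord_mulP10 mulr0.
    by rewrite coord_mulP10 mul0r.
  + exact: xd.
Qed.

(** * The three exponentials as projections of H *)

Definition exp_P0 : dualtens H := dt_exp (x (1, 0, 0)%N) P0.
Definition exp_P1 : dualtens H := dt_exp (x (0, 1, 0)%N) P1.
Definition exp_K : dualtens H := dt_exp (x (0, 0, 1)%N) K.

Let P0E n : P0 ^+ n = e (n, 0, 0)%N.
Proof. by rewrite /e /pbw /= !mulr1. Qed.
Let P1E n : P1 ^+ n = e (0, n, 0)%N.
Proof. by rewrite /e /pbw /= mulr1 mul1r. Qed.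
Let KE n : K ^+ n = e (0, 0, n)%N.
Proof. by rewrite /e /pbw /= !mul1r. Qed.

Let iP0K : cancel (fun n => (n, 0, 0)%N) (fun i : nat * nat * nat => i.1.1).
Proof. by []. Qed.
Let iP1K : cancel (fun n => (0, n, 0)%N) (fun i : nat * nat * nat => i.1.2).
Proof. by []. Qed.
Let iKK : cancel (fun n => (0, 0, n)%N) (fun i : nat * nat * nat => i.2).
Proof. by []. Qed.

Lemma exp_P0_summable : dt_summable (dt_exp_term (x (1, 0, 0)%N) P0).
Proof. exact: (dt_exp_summable (X := P0) be dx iP0K dual_exp_P0 P0E). Qed.
Lemma exp_P1_summable : dt_summable (dt_exp_term (x (0, 1, 0)%N) P1).
Proof. exact: (dt_exp_summable (X := P1) be dx iP1K dual_exp_P1 P1E). Qed.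
Lemma exp_K_summable : dt_summable (dt_exp_term (x (0, 0, 1)%N) K).
Proof. exact: (dt_exp_summable (X := K) be dx iKK dual_exp_K KE). Qed.

Lemma exp_P0_pbw a b c :
  exp_P0 (e (a, b, c)) = if (b + c == 0)%N then e (a, 0, 0)%N else 0.
Proof.
case: eqP => [/eqP|bc].
  rewrite addn_eq0 => /andP[/eqP-> /eqP->].
  exact: (dt_exp_basis (X := P0) be dx iP0K dual_exp_P0 P0E).
apply: (dt_exp_basis0 (X := P0) be dx iP0K dual_exp_P0 P0E) => n.
by apply: contra_not_neq bc => -[_ <- <-].
Qed.

Lemma exp_P1_pbw a b c :
  exp_P1 (e (a, b, c)) = if (a + c == 0)%N then e (0, b, 0)%N else 0.
Proof.
case: eqP => [/eqP|bc].
  rewrite addn_eq0 => /andP[/eqP-> /eqP->].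
  exact: (dt_exp_basis (X := P1) be dx iP1K dual_exp_P1 P1E).
apply: (dt_exp_basis0 (X := P1) be dx iP1K dual_exp_P1 P1E) => n.
by apply: contra_not_neq bc => -[<- _ <-].
Qed.

Lemma exp_K_pbw a b c :
  exp_K (e (a, b, c)) = if (a + b == 0)%N then e (0, 0, c)%N else 0.
Proof.
case: eqP => [/eqP|bc].
  rewrite addn_eq0 => /andP[/eqP-> /eqP->].
  exact: (dt_exp_basis (X := K) be dx iKK dual_exp_K KE).
apply: (dt_exp_basis0 (X := K) be dx iKK dual_exp_K KE) => n.
by apply: contra_not_neq bc => -[<- <- _].
Qed.

Lemma exp_P0_mulP0 h : exp_P0 (P0 * h) = P0 * exp_P0 h.
Proof.
apply: (topological_basis_ext (f := exp_P0 \o (P0 \*o idfun))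
  (g := P0 \*o exp_P0) be cH) => -[[a b] c] /=.
rewrite pbw_mulP0 !exp_P0_pbw; case: ifP => _; last by rewrite mulr0.
by rewrite pbw_mulP0.
Qed.

Lemma exp_P0_mulP1 h : exp_P0 (P1 * h) = 0.
Proof.
apply: (topological_basis_ext (f := exp_P0 \o (P1 \*o idfun))
  (g := \0) be cH) => -[[a b] c] /=.
by rewrite pbw_mulP1 exp_P0_pbw.
Qed.

Lemma exp_P0_mulK h : exp_P0 (h * K) = 0.
Proof.
apply: (topological_basis_ext (f := exp_P0 \o (K \o* idfun))
  (g := \0) be cH) => -[[a b] c] /=.
by rewrite pbw_mulK exp_P0_pbw addnS.
Qed.

(** The values of [exp_P0] are series in P0, which commutes with P1. This lets P1 pass to the front
    of a product in [exp_P01_mulP1]. *)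
Lemma exp_P0_commP1 h : exp_P0 h * P1 = P1 * exp_P0 h.
Proof.
apply: (topological_basis_ext (f := P1 \o* exp_P0)
  (g := P1 \*o exp_P0) be cH) => -[[a b] c] /=.
rewrite exp_P0_pbw; case: ifP => _; last by rewrite mul0r mulr0.
by rewrite -P0E; apply: esym (commrX _ commP0P1).
Qed.

Lemma exp_P1_mulP0 h : exp_P1 (P0 * h) = 0.
Proof.
apply: (topological_basis_ext (f := exp_P1 \o (P0 \*o idfun))
  (g := \0) be cH) => -[[a b] c] /=.
by rewrite pbw_mulP0 exp_P1_pbw.
Qed.

Lemma exp_P1_mulP1 h : exp_P1 (P1 * h) = P1 * exp_P1 h.
Proof.
apply: (topological_basis_ext (f := exp_P1 \o (P1 \*o idfun))
  (g := P1 \*o exp_P1) be cH) => -[[a b] c] /=.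
rewrite pbw_mulP1 !exp_P1_pbw; case: ifP => _; last by rewrite mulr0.
by rewrite pbw_mulP1.
Qed.

Lemma exp_P1_mulK h : exp_P1 (h * K) = 0.
Proof.
apply: (topological_basis_ext (f := exp_P1 \o (K \o* idfun))
  (g := \0) be cH) => -[[a b] c] /=.
by rewrite pbw_mulK exp_P1_pbw addnS.
Qed.

Lemma exp_K_mulP0 h : exp_K (P0 * h) = 0.
Proof.
apply: (topological_basis_ext (f := exp_K \o (P0 \*o idfun))
  (g := \0) be cH) => -[[a b] c] /=.
by rewrite pbw_mulP0 exp_K_pbw.
Qed.

Lemma exp_K_mulP1 h : exp_K (P1 * h) = 0.
Proof.
apply: (topological_basis_ext (f := exp_K \o (P1 \*o idfun))
  (g := \0) be cH) => -[[a b] c] /=.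
by rewrite pbw_mulP1 exp_K_pbw addnS.
Qed.

Lemma exp_K_mulK h : exp_K (h * K) = exp_K h * K.
Proof.
apply: (topological_basis_ext (f := exp_K \o (K \o* idfun))
  (g := K \o* exp_K) be cH) => -[[a b] c] /=.
rewrite pbw_mulK !exp_K_pbw; case: ifP => _; last by rewrite mul0r.
by rewrite pbw_mulK.
Qed.

Lemma exp_K_expP0 h : exp_K (E * h) = exp_K h.
Proof.
pose F : {linear H -> H} := exp_K \o (h \o* idfun).
rewrite -[LHS]/(F E) (linear_adic_exp _ cH (F := F)) /= ?mul1r //.
  exact: linearP.
by move=> m; rewrite /= exprS -mulrA exp_K_mulP0.
Qed.

(** * The convolution product of the exponentials is the identity *)

Lemma exp_P01_mulP0 h :
  dt_mul exp_P0 exp_P1 (P0 * h) = P0 * dt_mul exp_P0 exp_P1 h.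
Proof.
rewrite dt_mulE conv_coproductP0 addrC (conv_mull0 cH) ?add0r => [|u v].
  by apply: (conv_mull cH) => u v; rewrite exp_P0_mulP0 mul1r mulrA.
by rewrite exp_P1_mulP0 mulr0.
Qed.

(** The summand P1 (x) E dies under [exp_P0]; in 1 (x) P1 the factor P1 comes out of [exp_P1] and
    moves left past the value of [exp_P0]. *)
Lemma exp_P01_mulP1 h :
  dt_mul exp_P0 exp_P1 (P1 * h) = P1 * dt_mul exp_P0 exp_P1 h.
Proof.
rewrite dt_mulE conv_coproductP1 (conv_mull0 cH) ?add0r => [|u v].
  apply: (conv_mull cH) => u v.
  by rewrite exp_P1_mulP1 mul1r !mulrA exp_P0_commP1.
by rewrite exp_P0_mulP1 mul0r.
Qed.

Lemma exp_P01_mulK h : dt_mul exp_P0 exp_P1 (h * K) = 0.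
Proof.
rewrite dt_mulE conv_coproductK !(conv_mulr0 cH) ?addr0 // => u v.
  by rewrite exp_P1_mulK mulr0.
by rewrite exp_P0_mulK mul0r.
Qed.

Lemma exp_P01K : dt_mul (dt_mul exp_P0 exp_P1) exp_K =
  (idfun : {linear H -> H}).
Proof.
have exp1 : [/\ exp_P0 1 = 1, exp_P1 1 = 1 & exp_K 1 = 1].
  by rewrite -pbw1 exp_P0_pbw exp_P1_pbw exp_K_pbw.
have [P01 P11 K1] := exp1.
apply: linear_ext; apply: pbw_ext => // [|h IH|h IH|h IH].
- rewrite dt_mulE conv_coproduct1 // [dt_mul _ _ 1]dt_mulE conv_coproduct1 //.
  by rewrite P01 P11 K1 !mul1r.
(* [exp_K] kills the summand 1 (x) P0, so P0 (x) 1 alone contributes. *)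
- transitivity (P0 * dt_mul (dt_mul exp_P0 exp_P1) exp_K h); last by rewrite IH.
  rewrite [LHS]dt_mulE conv_coproductP0 addrC.
  rewrite (conv_mull0 cH) ?add0r => [|u v]; last by rewrite exp_K_mulP0 mulr0.
  by apply: (conv_mull cH) => u v; rewrite exp_P01_mulP0 mul1r mulrA.
(* Now P1 (x) E survives, and [exp_K] does not see the left factor [E]. *)
- transitivity (P1 * dt_mul (dt_mul exp_P0 exp_P1) exp_K h); last by rewrite IH.
  rewrite [LHS]dt_mulE conv_coproductP1 addrC.
  rewrite (conv_mull0 cH) ?add0r => [|u v]; last by rewrite exp_K_mulP1 mulr0.
  by apply: (conv_mull cH) => u v; rewrite exp_P01_mulP1 exp_K_expP0 mulrA.
(* For K the roles are exchanged: K (x) E is killed by the first factor and 1 (x) K remains. *)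
- transitivity (dt_mul (dt_mul exp_P0 exp_P1) exp_K h * K); last by rewrite IH.
  rewrite [LHS]dt_mulE conv_coproductK.
  rewrite (conv_mulr0 cH) ?add0r => [|u v]; last by rewrite exp_P01_mulK mul0r.
  by apply: (conv_mulr cH) => u v; rewrite exp_K_mulK mulr1 mulrA.
Qed.

End KappaPoincare.

(** * Factorization of the universal T-matrix *)

Theorem proposition2p1 (R : realType) (H : hopfAlgebra R) (P0 P1 K : H)
    (kP : kappa_poincare P0 P1 K) (x : nat * nat * nat -> dual H)
    (dx : dual_basis (pbw P0 P1 K) x) :
  let a0 := x (1, 0, 0)%N in
  let a1 := x (0, 1, 0)%N in
  let chi := x (0, 0, 1)%N in
  [/\ dt_summable (Tmatrix_term (pbw P0 P1 K) x),
      dt_summable (dt_exp_term a0 P0),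
      dt_summable (dt_exp_term a1 P1),
      dt_summable (dt_exp_term chi K) &
      Tmatrix (pbw P0 P1 K) x =
        dt_mul (dt_mul (dt_exp a0 P0) (dt_exp a1 P1)) (dt_exp chi K)].
Proof.
move=> a0 a1 chi; have TS := has_dt_sum_Tmatrix (kp_basis kP) dx.
split.
- by exists (idfun : {linear H -> H}).
- exact: exp_P0_summable kP _ dx.
- exact: exp_P1_summable kP _ dx.
- exact: exp_K_summable kP _ dx.
by rewrite /Tmatrix (dt_sumE TS) -(exp_P01K kP dx).
Qed.
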